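(* Let $G$ be a semigroup, let $C\subseteq G$ be a nice subsemigroup, and let $\Sigma$ be a finite non-empty set of retractions of $G$ onto $C$. Let $\bar s=\langle s_i:i<\omega\rangle\in(G\setminus C)^\omega$. Then for every finite coloring of $G$ there are an increasing sequence of positive integers $\langle n_i:i<\omega\rangle$ and elements $a_i\in\mathrm{fp}^{\Sigma}\big(s_{\restriction[n_i,n_{i+1})}\big)\setminus C$ ($i<\omega$) such that, for $\bar a=\langle a_i:i<\omega\rangle$, the set $\mathrm{fp}^{\Sigma}\bar a\setminus C$ is monochromatic.
   Context: A subsemigroup $C\subseteq G$ is nice if $a\cdot b\in C$ implies $a,b\in C$. A retraction of $G$ onto $C$ is a homomorphism $\sigma:G\to C$ with $\sigma(c)=c$ for $c\in C$ (regarded as an endomorphism of $G$). For a tuple $\bar a$ of elements of $G$ of length $\le\omega$, $\mathrm{fp}^{\Sigma}\bar a$ is the set of all products $\sigma_0(a_{i_0})\cdots\sigma_k(a_{i_k})$ with $k<|\bar a|$, $i_0<\dots<i_k<|\bar a|$ and each $\sigma_j\in\Sigma\cup\{\mathrm{id}_G\}$. $s_{\restriction[m,m')}$ denotes the finite tuple $\langle s_m,s_{m+1},\dots,s_{m'-1}\rangle$. A finite coloring of $G$ is a map $G\to\{1,\dots,k\}$; a subset is monochromatic if the map is constant on it. *)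

(* Defs.v *)
From HB Require Import structures.
From mathcomp Require Import all_boot.
From mathcomp Require Import boolp classical_sets functions cardinality.

Set Implicit Arguments.
Unset Strict Implicit.
Unset Printing Implicit Defensive.

Local Open Scope classical_set_scope.
Local Open Scope group_scope.

Definition subsemigroup (G : semigroupType) (C : set G) : Prop :=
  forall a b, C a -> C b -> C (a * b).

Definition nice (G : semigroupType) (C : set G) : Prop :=
  forall a b, C (a * b) -> C a /\ C b.

Definition retraction (G : semigroupType) (C : set G) (sigma : G -> G) : Prop :=
  [/\ {morph sigma : x y / x * y},
      forall x, C (sigma x) &
      forall c, C c -> sigma c = c].

(* sprod f k = f 0 * f 1 * ... * f k: a product of k + 1 factors, so that no
   unit is needed. *)
Fixpoint sprod (G : semigroupType) (f : nat -> G) (k : nat) : G :=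
  if k is k'.+1 then sprod f k' * f k else f 0.

(* A tuple of length L <= omega is given by a function on nat of which only the
   values on L matter.  The ordinal L is the set of its elements: `I_n for the
   length n, [set: nat] for the length omega. *)
Definition fp (G : semigroupType) (Sigma : set (G -> G)) (L : set nat)
    (a : nat -> G) : set G :=
  [set x | exists (k : nat) (i : nat -> nat) (sigma : nat -> G -> G),
    [/\ L k,
        forall j, (j < k)%N -> (i j < i j.+1)%N,
        L (i k),
        forall j, (j <= k)%N -> (Sigma `|` [set idfun]) (sigma j) &
        x = sprod (fun j => sigma j (a (i j))) k]].

(* fp of the tuple <s_m, ..., s_(m' - 1)>, of length m' - m. *)
Definition fp_restr (G : semigroupType) (Sigma : set (G -> G)) (s : nat -> G)
    (m m' : nat) : set G :=
  fp Sigma `I_(m' - m) (fun j => s (m + j)%N).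

Definition monochromatic (T K : Type) (col : T -> K) (A : set T) : Prop :=
  forall x y, A x -> A y -> col x = col y.

(* Main.v *)
Require Import Defs.
From mathcomp Require Import all_boot.
From mathcomp Require Import boolp classical_sets functions cardinality.
From mathcomp Require Import filter topology.

Set Implicit Arguments.
Unset Strict Implicit.
Unset Printing Implicit Defensive.

Local Open Scope classical_set_scope.

(** Let beta(G) be the ultrafilters on G, a compact right topological semigroup.
    The ultrafilters containing every tail fp of s form a closed subsemigroup S;
    those also containing C form a closed subsemigroup T, the others a closed
    ideal J.  Take an idempotent v in a minimal closed left ideal of T and an
    idempotent u in J with uv = vu = u.  Each retraction sigma sends u to an
    idempotent of T below v, so sigma(u) = v by minimality.  Hence a product of
    copies of u and sigma(u), sigma in Sigma, is u as soon as one factor is u,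
    and is v otherwise; since C is nice, the first case corresponds to the
    products of letters outside C.  The Galvin-Glazer construction then yields
    the letters a_i, with these products in a colour class belonging to u. *)

(** * Minimal closed sets and idempotents in compact right topological semigroups *)

Section CompactRightTopologicalSemigroup.

(** Zorn's lemma is applied to the sets removed from [A]: the union of a chain of them leaves an
    intersection, nonempty by compactness. [R] stays abstract so as to serve both subsemigroups and
    left ideals. *)
Lemma minimal_closed_subset (X : topologicalType) (R : set (set X))
    (A : set X) :
    compact [set: X] ->
    (forall F : set (set X), F `<=` R -> R (\bigcap_(B in F) B)) ->
    closed A -> A !=set0 -> R A ->
  exists M, [/\ closed M, M !=set0, R M, M `<=` A &
    forall N, closed N -> N !=set0 -> R N -> N `<=` M -> M `<=` N].
Proof.
move=> cX capR clA A0 RA.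
pose P B := [/\ closed (A `\` B), A `\` B !=set0 & R (A `\` B)].
have [F FP totF|B [[clB B0 RB] maxB]] := @Zorn_bigcup X P.
  have [->|/set0P[Z FZ]] := eqVneq F set0.
    by rewrite /P bigcup_set0 setD0.
  have AF : A `\` \bigcup_(B in F) B =
      \bigcap_(D in [set A `\` B | B in F]) D.
    apply/seteqP; split=> [x [Ax nFx] _ [B FB <-]|x xF].
      by split=> // Bx; apply: nFx; exists B.
    split; first by have [] := xF _ (imageP (fun B => A `\` B) FZ).
    by case=> B FB Bx; have [] := xF _ (imageP (fun B => A `\` B) FB).
  have FF : ProperFilter (filter_from F (fun B => A `\` B)).
    apply: filter_from_proper; last by move=> B /FP[].
    apply: filter_from_filter; first by exists Z.
    move=> B D FB FD; have [BD|DB] := totF _ _ FB FD.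
      by exists D => // x [Ax Dx]; split; split=> // /BD.
    by exists B => // x [Ax Bx]; split; split=> // /DB.
  have [x [_ clx]] := cX _ FF filterT.
  rewrite /P AF; split.
  - by apply: closed_bigI => _ [B /FP[? _ _] <-].
  - exists x => _ [B FB <-]; have [clB _ _] := FP _ FB.
    by apply: clB => U Ux; apply: clx => //; exists B.
  - by apply: capR => _ [B /FP[_ _ ?] <-].
exists (A `\` B); split=> // N clN N0 RN NM x [Ax Bx].
apply: contrapT => Nx; apply: (maxB (~` N)).
  by split=> [y By /NM[]//|/(_ x Nx)].
rewrite /P; have -> // : A `\` ~` N = N.
by apply/seteqP; split=> [y [_ /contrapT]|y Ny]//; split=> //; case: (NM _ Ny).
Qed.

Variables (X : topologicalType) (op : X -> X -> X).
Hypotheses (cX : compact [set: X]) (hX : hausdorff_space X).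
Hypotheses (opA : associative op) (opc : forall q, continuous (op^~ q)).

Let closed_rtranslate (A : set X) q : closed A -> closed [set op x q | x in A].
Proof.
move=> clA; apply: compact_closed => //; apply: continuous_compact.
  exact: continuous_subspaceT.
by apply: (subclosed_compact clA cX).
Qed.

(** In a minimal closed subsemigroup [T] containing [x], [T x = T] gives some [z] with [z x = x].
    The elements [z] of [T] with this property form a closed subsemigroup, hence all of [T], and [x]
    is one of them. *)
Lemma ellis (S : set X) : closed S -> S !=set0 ->
  (forall x y, S x -> S y -> S (op x y)) -> exists2 e, S e & op e e = e.
Proof.
move=> clS S0 SS.
have [|T [clT [x Tx] TT TS minT]] := @minimal_closed_subset X
  [set A | forall x y, A x -> A y -> A (op x y)] S cX _ clS S0 SS.
  move=> F FR x y Fx Fy B FB; exact: FR (Fx _ FB) (Fy _ FB).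
exists x; first exact: TS.
have [||||z Tz zx] := minT [set op y x | y in T] _ _ _ _ x Tx.
- exact: closed_rtranslate.
- by exists (op x x), x.
- move=> _ _ [y Ty <-] [z Tz <-]; exists (op (op y x) z); last by rewrite opA.
  by apply: (TT) => //; apply: TT.
- by move=> _ [y Ty <-]; apply: TT.
have clx : closed [set y | op y x = x].
  apply: (@preimage_closed _ _ (op^~ x) [set x]).
    by move=> y _; exact: (@opc x y).
  exact/accessible_closed_set1/hausdorff_accessible.
have [||||] // := minT (T `&` [set y | op y x = x]) _ _ _ _ x Tx.
- exact: closedI.
- by exists z.
- by move=> y1 y2 [T1 y1x] [T2 /= y2x]; split; [exact: TT|rewrite /= -opA y2x].
Qed.

(** The idempotent [v] is taken in a minimal closed left ideal [L] of [T]. An idempotent [w] of [T]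
    below [v] lies in [L], so [T w = L] contains [v]; from [v = t w] follows [v w = v], hence
    [w = v]. *)
Lemma dominated_idempotents (S T J : set X) :
    closed T -> T !=set0 -> closed J -> J !=set0 -> T `<=` S -> J `<=` S ->
    (forall x y, T x -> T y -> T (op x y)) ->
    (forall x y, S x -> J y -> J (op x y)) ->
    (forall x y, J x -> S y -> J (op x y)) ->
  exists u v, [/\ J u, T v, op u u = u, op v v = v & op u v = u] /\
    op v u = u /\
    forall w, T w -> op w w = w -> op w v = w -> op v w = w -> w = v.
Proof.
move=> clT T0 clJ J0 TS JS TT SJ JSJ.
have [|L [clL L0 TL LT minL]] := @minimal_closed_subset X
  [set A | forall x y, T x -> A y -> A (op x y)] T cX _ clT T0 TT.
  by move=> F FR x y Tx Fy B FB; exact: FR Tx (Fy _ FB).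
have [|v Lv vv] := ellis clL L0; first by move=> x y /LT /TL; apply.
have Tv := LT _ Lv.
have [||x y|w [j Jj jw] ww] := @ellis [set op x v | x in J].
- exact: closed_rtranslate.
- by case: J0 => j Jj; exists (op j v), j.
- move=> [j Jj <-] [j' Jj' <-]; exists (op (op j v) j'); last by rewrite opA.
  by apply: SJ => //; apply: JS; apply: JSJ => //; exact: TS.
have wv : op w v = w by rewrite -jw -opA vv.
(* Membership of [w] in [J v] gives only [w v = w]; multiplying by [v] on the left puts the
   idempotent below [v] on both sides. *)
exists (op v w), v; split; [split=> //|split].
- by apply: SJ; [exact: TS|rewrite -jw; apply: JSJ => //; exact: TS].
- by rewrite -opA (opA w) wv ww.
- by rewrite -opA wv.
- by rewrite opA vv.
move=> {jw ww wv}w Tw ww wv vw.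
have Lw : L w by rewrite -wv; exact: TL.
have [||||t Tt tw] := minL [set op x w | x in T] _ _ _ _ v Lv.
- exact: closed_rtranslate.
- by exists (op w w), w.
- by move=> x _ Tx [y Ty <-]; exists (op x y); [exact: TT|rewrite opA].
- by move=> _ [y Ty <-]; exact: TL.
by rewrite -vw -tw -opA ww.
Qed.

End CompactRightTopologicalSemigroup.

(** * Ultrafilters as points of a compact space of Boolean functions *)

Section StoneCech.
Variable G : semigroupType.

(* All Boolean functions on the power set, not only the ultrafilters, form a
   compact right topological semigroup under the usual product of ultrafilters:
   Tychonoff's theorem then replaces the construction of the topology of the
   Stone-Cech compactification. *)
Let X := {ptws (set G) -> bool}.
Implicit Types (p q u v : X) (A B : set G).

Definition umul p q : X := fun A => p [set x | q [set y | A (x * y)%g]].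

Definition umap (f : G -> G) p : X := fun A => p (f @^-1` A).

(** Each identity relates finitely many coordinates, so the ultrafilters form a closed set.
    Exclusion of the empty set and upward closure follow. *)
Definition ultra p :=
  (forall A, p (~` A) = ~~ p A) /\ (forall A B, p (A `&` B) = p A && p B).

Lemma umulA : associative umul.
Proof.
move=> p q r; apply/funext => A; rewrite /umul; congr (p _).
apply/funext => x; congr (is_true (q _)).
apply/funext => y; congr (is_true (r _)).
by apply/funext => z /=; rewrite mulgA.
Qed.

Lemma umul_umap f p q : {morph f : x y / (x * y)%g} ->
  umap f (umul p q) = umul (umap f p) (umap f q).
Proof.
move=> fM; apply/funext => A; rewrite /umap /umul; congr (p _).
apply/funext => x; congr (is_true (q _)).
by apply/funext => y /=; rewrite fM.
Qed.

Lemma near_coordinate p A : \forall q \near p, q A = p A.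
Proof.
have := @proj_continuous (set G) (fun=> bool) A p [set b | b = p A].
by apply; rewrite nbhs_principalE.
Qed.

(** The coordinate of [umul r q] at [A] is a coordinate of [r], at a set that depends only on [q]
    and [A]. *)
Lemma umul_continuous q : continuous (umul^~ q : X -> X).
Proof.
move=> p; apply/cvg_sup => A U [_ [[W oW <-] /= WpA WU]].
have := near_coordinate p [set x | q [set y | A (x * y)%g]].
by apply: filterS => r rA; apply: WU; rewrite /= {1}/umul rA.
Qed.

Lemma closed_coordinate A b : closed [set p : X | p A = b].
Proof.
rewrite closedE => p /=; apply: contra_notP => pA.
by have := near_coordinate p A; apply: filterS => q ->.
Qed.

Lemma closed_ultra : closed (ultra : set X).
Proof.
rewrite closedE => p; apply: contra_notP => up.
have [/existsNP[A pA]|/existsNP[A /existsNP[B pAB]]] := (not_andP _ _).1 up.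
  have := near_coordinate p A; have := near_coordinate p (~` A).
  by apply: filterS2 => q qA qA' [/(_ A) + _]; rewrite qA qA'.
have := near_coordinate p A; have := near_coordinate p B.
have := near_coordinate p (A `&` B).
by apply: filterS3 => q qA qB qAB [_ /(_ A B)]; rewrite qA qB qAB.
Qed.

Lemma ultra_set0 p : ultra p -> p set0 = false.
Proof. by move=> [pC pI]; rewrite -(setICr set0) pI pC andbN. Qed.

Lemma ultra_setT p : ultra p -> p setT.
Proof. by move=> up; rewrite -setC0 up.1 ultra_set0. Qed.

Lemma ultraS p A B : ultra p -> A `<=` B -> p A -> p B.
Proof. by move=> [_ pI] /setIidPl {1}<-; rewrite pI => /andP[]. Qed.

Lemma ultra_ex p A : ultra p -> p A -> A !=set0.
Proof.
by move=> up; have [->|/set0P//] := eqVneq A set0; rewrite ultra_set0.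
Qed.

(** The finiteness of [Sigma] and of the set of colours enters the proof through this property. *)
Lemma ultra_finite_forall p (I : eqType) (D : set I) (A : I -> set G) :
  ultra p -> finite_set D -> (forall i, D i -> p (A i)) ->
  p [set x | forall i, D i -> A i x].
Proof.
move=> up /finite_seqP[s ->].
elim: s => [|i s IHs] pA; first exact: ultraS (ultra_setT up).
have := IHs (fun j js => pA j (mem_behead (s := i :: s) js)).
have := pA i (mem_head _ _) => pAi pAs.
have : p (A i `&` [set x | forall j, j \in s -> A j x]) by rewrite up.2 pAi.
by apply: ultraS => // x [Aix Asx] j; rewrite /= inE => /predU1P[->|/Asx].
Qed.

Lemma ultra_umul p q : ultra p -> ultra q -> ultra (umul p q).
Proof.
move=> [pC pI] [qC qI]; split=> [A|A B]; rewrite /umul.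
  rewrite -pC; congr (p _); apply/funext => x; apply/propext.
  have := qC [set y | A (x * y)%g].
  by rewrite /= => ->; split=> /negP.
rewrite -pI; congr (p _); apply/funext => x; apply/propext.
have := qI [set y | A (x * y)%g] [set y | B (x * y)%g].
by rewrite /= => ->; split=> /andP.
Qed.

Lemma ultra_umap f p : ultra p -> ultra (umap f p).
Proof. by move=> [pC pI]; split=> *; rewrite /umap -?pC -?pI. Qed.

Lemma ptws_bool_compact : compact [set: X].
Proof.
have := @tychonoff (set G) (fun=> bool) (fun=> setT) (fun=> bool_compact).
by congr (compact _); rewrite eqEsubset.
Qed.

Lemma ptws_bool_hausdorff : hausdorff_space X.
Proof. by apply: hausdorff_product => ?; exact: discrete_hausdorff. Qed.

End StoneCech.

(** * Finite products over tails of the sequence *)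

Section FiniteProducts.
Variables (G : semigroupType) (C : set G) (Sigma : set (G -> G)).
Variable s : nat -> G.

Lemma sprod_cat (f : nat -> G) k l :
  sprod f (k + l).+1 = (sprod f k * sprod (fun j => f (k + j).+1) l)%g.
Proof.
elim: l => [|l IHl]; first by rewrite /= addn0.
rewrite addnS -[LHS]/(sprod f (k + l).+1 * f (k + l).+2)%g IHl -mulgA.
by rewrite /= addnS.
Qed.

Lemma eq_sprod (f g : nat -> G) k :
  (forall j, (j <= k)%N -> f j = g j) -> sprod f k = sprod g k.
Proof.
elim: k => [|k IHk] fg /=; first exact: fg.
by rewrite fg // IHk // => j jk; apply: fg; exact: leqW.
Qed.

Lemma sprod_morph (h : G -> G) (f : nat -> G) k :
  {morph h : x y / (x * y)%g} -> h (sprod f k) = sprod (h \o f) k.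
Proof. by move=> hM; elim: k => //= k IHk; rewrite hM IHk. Qed.

Lemma increasing_ge_index (i : nat -> nat) k :
  (forall j, (j < k)%N -> (i j < i j.+1)%N) ->
  forall j, (j <= k)%N -> (j <= i j)%N.
Proof.
move=> ii; elim=> // j IHj jk.
exact: leq_ltn_trans (IHj (ltnW jk)) (ii _ jk).
Qed.

Definition fp_tail (n : nat) : set G :=
  fp Sigma [set: nat] (fun j => s (n + j)%N).

Lemma fp_tail_letter n i : (n <= i)%N -> fp_tail n (s i).
Proof.
move=> ni; exists 0%N, (fun=> (i - n)%N), (fun=> idfun); split=> //.
  by move=> j _; right.
by rewrite /= subnKC.
Qed.

Lemma fp_tail_bounded n x :
  fp_tail n x -> exists2 m, (n < m)%N & fp_restr Sigma s n m x.
Proof.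
(* The bound is one past the last letter used; the length condition on [k] then follows from
   [k <= i k]. *)
move=> [k [i [tau [_ ii _ tauS ->]]]]; exists (n + (i k).+1)%N.
  by rewrite addnS ltnS leq_addr.
exists k, i, tau; split=> //=; rewrite addKn // ltnS.
exact: increasing_ge_index ii _ _.
Qed.

Lemma fp_tailM n m x y :
  fp_restr Sigma s n m x -> fp_tail m y -> fp_tail n (x * y)%g.
Proof.
move=> [k [i [tau [_ ii /= ik tauS ->]]]] [l [j [rho [_ jj _ rhoS ->]]]].
have nm : (n <= m)%N by rewrite ltnW // -subn_gt0 (leq_ltn_trans _ ik).
(* The indices of [y] are counted from [m]; adding [m - n] counts them from [n] and puts them beyond
   [i k], which is less than [m - n]. *)
exists (k + l).+1,
  (fun h => if (h <= k)%N then i h else m - n + j (h - k.+1))%N,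
  (fun h => if (h <= k)%N then tau h else rho (h - k.+1)%N); split=> //.
- move=> h; rewrite ltnS => hkl; case: (ltngtP h k) => [hk|kh|->].
  + exact: ii.
  + rewrite subSn // ltn_add2l; apply: jj.
    by rewrite ltn_subLR // addSn ltnS.
  + by rewrite subnn ltn_addr.
- move=> h hkl; case: leqP => hk; first exact: tauS.
  by apply: rhoS; rewrite leq_subLR addSn.
- rewrite sprod_cat; congr (_ * _)%g; apply: eq_sprod => h hk.
    by rewrite hk.
  by rewrite ltnNge leq_addr /= subSS addKn addnA subnKC.
Qed.

(** Since [sigma] fixes [C] pointwise, it absorbs every retraction already applied to a letter, and
    it replaces each [idfun] by [sigma]. *)
Lemma fp_tail_retraction n sigma x :
  (forall tau, Sigma tau -> retraction C tau) -> Sigma sigma ->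
  fp_tail n x -> fp_tail n (sigma x).
Proof.
move=> SigmaC Ss [k [i [tau [_ ii _ tauS ->]]]].
have [sM _ sid] := SigmaC _ Ss.
exists k, i, (fun j => if pselect (Sigma (tau j)) then tau j else sigma).
split=> //; first by move=> j _; case: pselect; left.
rewrite sprod_morph //; apply: eq_sprod => j jk /=.
case: pselect => [Stau|nS] /=.
  by apply: sid; have [_ + _] := SigmaC _ Stau; apply.
by have [/nS//|->] := tauS _ jk.
Qed.

End FiniteProducts.

(** The image under [s] of an ultrafilter finer than the eventuality filter; it witnesses that the
    ideal [J] is nonempty. *)
Lemma exists_ultra_tails (G : semigroupType) (s : nat -> G) :
  exists2 p, ultra p &
    forall (A : set G) n, (forall i, (n <= i)%N -> A (s i)) -> p A.
Proof.
have [D [DU oD]] := ultraFilterLemma eventually_filter.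
exists (fun A => `[< D (s @^-1` A) >]); last first.
  by move=> A n nA; apply/asboolP/oD; exists n.
split=> [A|A B].
  apply/asboolP/asboolPn => [DnA DA|].
    by have [i []] := filter_ex (filterI DA DnA).
  by have [] := in_ultra_setVsetC (s @^-1` A) DU.
apply/asboolP/andP => [DAB|[/asboolP DA /asboolP DB]]; last exact: filterI.
by split; apply/asboolP; apply: filterS DAB => i [].
Qed.

(** * Retractions acting on ultrafilters, and the choice of letters *)

Section Retractions.
Variables (G : semigroupType) (C : set G) (Sigma : set (G -> G)).
Variable s : nat -> G.
Hypotheses (CC : subsemigroup C) (niceC : nice C).
Hypotheses (Sigma_fin : finite_set Sigma) (Sigma0 : Sigma !=set0).
Hypothesis SigmaC : forall sigma, Sigma sigma -> retraction C sigma.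
Hypothesis sC : forall i, ~ C (s i).
Implicit Types (p q u v : {ptws set G -> bool}) (A B : set G).

Lemma umap_retraction p sigma :
  ultra p -> p C -> retraction C sigma -> umap sigma p = p.
Proof.
move=> up pC [_ _ sid]; apply/funext => A; rewrite /umap.
have pIC B : p B = p (B `&` C) by rewrite up.2 pC andbT.
rewrite [LHS]pIC [RHS]pIC; congr (p _).
by apply/seteqP; split=> x [/= + Cx]; rewrite sid.
Qed.

(** A product [x] from tail [n] uses only letters before some [m], so it can be followed by any [y]
    from tail [m], and these are [q]-large. *)
Lemma umul_fp_tail p q :
  ultra p -> ultra q -> (forall n, p (fp_tail Sigma s n)) ->
  (forall n, q (fp_tail Sigma s n)) ->
  forall n, umul p q (fp_tail Sigma s n).
Proof.
move=> up uq pF qF n; apply: (ultraS up _ (pF n)) => x /fp_tail_bounded[m _ xm].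
by apply: (ultraS uq _ (qF m)) => y; exact: fp_tailM xm.
Qed.

Lemma ultra_idempotents : exists u v,
  [/\ ultra u, ultra v, forall n, u (fp_tail Sigma s n) & u C = false] /\
  [/\ umul u u = u, umul v v = v, umul u v = u, umul v u = u &
    forall sigma, Sigma sigma -> umap sigma u = v].
Proof.
pose S := [set p | ultra p] `&`
  \bigcap_n [set p : {ptws set G -> bool} | p (fp_tail Sigma s n) = true].
pose T := S `&` [set p : {ptws set G -> bool} | p C = true].
pose J := S `&` [set p : {ptws set G -> bool} | p C = false].
have clS : closed S.
  apply: closedI; first exact: closed_ultra.
  by apply: closed_bigI => n _; exact: closed_coordinate.
have SS p q : S p -> S q -> S (umul p q).
  move=> [up pF] [uq qF]; split; first exact: ultra_umul.
  by move=> n _; apply: umul_fp_tail => // m; [exact: (pF m I)|exact: (qF m I)].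
have TT p q : T p -> T q -> T (umul p q).
  move=> [Sp pC] [Sq qC]; split; first exact: SS.
  apply: (ultraS Sp.1 _ pC) => x Cx.
  by apply: (ultraS Sq.1 _ qC) => y Cy; exact: CC.
have SigmaT p sigma : Sigma sigma -> S p -> T (umap sigma p).
  move=> Ss [up pF]; have [_ sC' _] := SigmaC Ss; split.
    split=> [|n _]; first exact: ultra_umap.
    apply: (ultraS up _ (pF n I)) => x; exact: (fp_tail_retraction SigmaC Ss).
  by apply: (ultraS up _ (ultra_setT up)) => x _; exact: sC'.
(* Niceness makes the complement of [C] a two-sided ideal of [G]; each half of it gives one of the
   ideal properties of [J]. *)
have SJ p q : S p -> J q -> J (umul p q).
  move=> [up pF] [[uq qF] qC]; split; first exact: SS.
  apply/negbTE/negP => /(ultra_ex up)[x] /= qx.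
  have : q C by apply: (ultraS uq _ qx) => y /niceC[].
  by rewrite qC.
have JS p q : J p -> S q -> J (umul p q).
  move=> [[up pF] pC] [uq qF]; split; first exact: SS.
  apply/negbTE/negP => pq.
  have : p C by apply: (ultraS up _ pq) => x /(ultra_ex uq)[y /niceC[]].
  by rewrite pC.
have J0 : J !=set0.
  have [p up pA] := exists_ultra_tails s; exists p; split.
    by split=> // n _; apply: (pA _ n) => i; exact: fp_tail_letter.
  apply/negbTE; rewrite -up.1; apply: (pA _ 0%N) => i _; exact: sC.
have T0 : T !=set0.
  have [sigma Ss] := Sigma0; have [p [Sp _]] := J0.
  by exists (umap sigma p); exact: SigmaT.
have [u [v [[Ju Tv uu vv uv] [vu uniqv]]]] :=
  @dominated_idempotents {ptws set G -> bool} (@umul G)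
    (@ptws_bool_compact G) (@ptws_bool_hausdorff G) (@umulA G)
    (@umul_continuous G) S T J
    (closedI clS (@closed_coordinate G C true)) T0
    (closedI clS (@closed_coordinate G C false)) J0
    (@subIsetl _ _ _) (@subIsetl _ _ _) TT SJ JS.
exists u, v; have [[ultu uF] uC] := Ju; have [[ultv vF] vC] := Tv.
split; split=> //; first by move=> n; exact: (uF n I).
move=> sigma Ss; have [sM _ _] := SigmaC Ss.
(* As [sigma] fixes [v], applying it to [uv = vu = u] shows that the image of [u] lies below [v]. *)
have sv : umap sigma v = v by apply: umap_retraction => //; exact: SigmaC.
apply: uniqv; first exact: SigmaT Ju.1.
- by rewrite -umul_umap // uu.
- by rewrite -{1}sv -umul_umap // uv.
- by rewrite -{1}sv -umul_umap // vu.
Qed.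

(** [refine A A a] restricts the later products outside [C], [refine A B a] those inside. With [a]
    outside [C], [a * y] always falls outside, hence under [A]; a factor [sigma a] leaves [y] on its
    side of [C]. *)
Definition refine (A B : set G) (a : G) : set G :=
  [set y | [/\ B y, A (a * y)%g &
    forall sigma, Sigma sigma -> B (sigma a * y)%g]].

(** Each of [uu = u], [uv = u], [vu = u] and [vv = v] makes one requirement on the letter hold
    [u]-almost everywhere, the last two through [sigma(u) = v]. A common point of these large sets
    is the letter. *)
Lemma ultra_choose_letter u v (A B : set G) n :
  ultra u -> ultra v -> (forall m, u (fp_tail Sigma s m)) -> u C = false ->
  umul u u = u -> umul v v = v -> umul u v = u -> umul v u = u ->
  (forall sigma, Sigma sigma -> umap sigma u = v) ->
  u A -> v B ->
  exists a m, [/\ (n < m)%N, (fp_restr Sigma s n m `\` C) a, A a &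
    forall sigma, Sigma sigma -> B (sigma a)] /\
    u (refine A A a) /\ v (refine A B a).
Proof.
move=> ultu ultv uF uC uu vv uv vu su uA vB.
have Su (D : set G) sigma : Sigma sigma -> v D -> u [set a | D (sigma a)].
  by move=> Ss; rewrite -(su _ Ss).
have u1 : u [set a | u [set y | A (a * y)%g]].
  by rewrite -[_ [set a | _]]/(umul u u A) uu.
have u2 : u [set a | v [set y | A (a * y)%g]].
  by rewrite -[_ [set a | _]]/(umul u v A) uv.
have u3 : u [set a | forall sigma, Sigma sigma ->
    u [set y | A (sigma a * y)%g]].
  apply: ultra_finite_forall => // sigma Ss.
  apply: (Su [set x | u [set y | A (x * y)%g]]) => //.
  by rewrite -[_ [set a | _]]/(umul v u A) vu.
have u4 : u [set a | forall sigma, Sigma sigma ->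
    v [set y | B (sigma a * y)%g]].
  apply: ultra_finite_forall => // sigma Ss.
  apply: (Su [set x | v [set y | B (x * y)%g]]) => //.
  by rewrite -[_ [set a | _]]/(umul v v B) vv.
have u5 : u [set a | forall sigma, Sigma sigma -> B (sigma a)].
  by apply: ultra_finite_forall => // sigma Ss; exact: Su.
have u6 : u (~` C) by rewrite ultu.1 uC.
have : u (A `&` ~` C `&` fp_tail Sigma s n `&`
    [set a | u [set y | A (a * y)%g]] `&` [set a | v [set y | A (a * y)%g]] `&`
    [set a | forall sigma, Sigma sigma -> u [set y | A (sigma a * y)%g]] `&`
    [set a | forall sigma, Sigma sigma -> v [set y | B (sigma a * y)%g]] `&`
    [set a | forall sigma, Sigma sigma -> B (sigma a)]).
  by rewrite !ultu.2 uA u6 uF u1 u2 u3 u4.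
case/(ultra_ex ultu) => a [[[[[[[Aa nCa] Fa] a1] a2] a3] a4] a5].
have [m nm am] := fp_tail_bounded Fa.
exists a, m; split; first by split.
split.
  have : u (A `&` [set y | A (a * y)%g] `&`
      [set y | forall sigma, Sigma sigma -> A (sigma a * y)%g]).
    by rewrite !ultu.2 uA a1; exact: ultra_finite_forall.
  by apply: ultraS => // y [[]].
have : v (B `&` [set y | A (a * y)%g] `&`
    [set y | forall sigma, Sigma sigma -> B (sigma a * y)%g]).
  by rewrite !ultv.2 vB a2; exact: ultra_finite_forall.
by apply: ultraS => // y [[]].
Qed.

(* [A n] receives the products outside [C] of the letters [a i], [n <= i], and
   [B n] those inside [C]. *)
Lemma fp_refine (A B : nat -> set G) (a : nat -> G) :
  (forall n, ~ C (a n)) -> (forall n, A n (a n)) ->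
  (forall n sigma, Sigma sigma -> B n (sigma (a n))) ->
  (forall n, A n.+1 `<=` refine (A n) (A n) (a n)) ->
  (forall n, B n.+1 `<=` refine (A n) (B n) (a n)) ->
  forall x, fp Sigma [set: nat] a x -> ~ C x -> A 0%N x.
Proof.
move=> aC Aa Ba AA BB.
have Amono n m : (n <= m)%N -> A m `<=` A n.
  move=> /subnK <-; elim: (m - n)%N => // d IHd x.
  by rewrite addSn => /AA[/IHd].
have Bmono n m : (n <= m)%N -> B m `<=` B n.
  move=> /subnK <-; elim: (m - n)%N => // d IHd x.
  by rewrite addSn => /BB[/IHd].
suff prodAB k : forall n (i : nat -> nat) (tau : nat -> G -> G), (n <= i 0)%N ->
    (forall j, (j < k)%N -> (i j < i j.+1)%N) ->
    (forall j, (j <= k)%N -> (Sigma `|` [set idfun]) (tau j)) ->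
    let x := sprod (fun j => tau j (a (i j))) k in
    (C x -> B n x) /\ (~ C x -> A n x).
  move=> x [k [i [tau [_ ii _ tauS ->]]]].
  by have [] := prodAB k 0%N i tau (leq0n _) ii tauS.
elim: k => [|k IHk] n i tau ni ii tauS /=.
  have [Stau|->] := tauS 0%N isT.
    have [_ tauC _] := SigmaC Stau.
    by split=> // _; apply: Bmono ni _ _; exact: Ba.
  by split=> [/aC//|_]; exact: Amono ni _ (Aa _).
(* The first letter is split off, because [refine] at stage [i 0] controls its product with later
   letters; [sprod] itself unfolds at the last factor. *)
pose y := sprod (fun j => tau j.+1 (a (i j.+1))) k.
have -> : (sprod (fun j => tau j (a (i j))) k * tau k.+1 (a (i k.+1)))%g =
    (tau 0%N (a (i 0%N)) * y)%g.
  by rewrite -[k.+1]/(0 + k).+1 -[LHS]/(sprod _ (0 + k).+1) sprod_cat.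
have [Cy nCy] : (C y -> B (i 0%N).+1 y) /\ (~ C y -> A (i 0%N).+1 y).
  apply: (IHk _ (i \o succn) (tau \o succn)) => [|j jk|j jk] /=.
  - exact: ii.
  - exact: ii.
  - exact: tauS.
(* A retracted first letter leaves the product on the same side of [C] as [y]; an unretracted one
   forces it outside, wherever [y] lies. *)
have [Stau|->] := tauS 0%N isT.
  have [_ tauC _] := SigmaC Stau; split=> [/niceC[_ /Cy/BB[_ _]]|nCx].
    by move=> /(_ _ Stau); exact: Bmono.
  have /nCy/AA[_ _ /(_ _ Stau)] : ~ C y by move=> /(CC (tauC _)).
  exact: Amono.
split=> [/niceC[/aC]//|_]; apply: (Amono _ _ ni).
by have [/Cy/BB[]|/nCy/AA[]] := pselect (C y).
Qed.

End Retractions.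

(** * The Galvin-Glazer recursion *)

Theorem theorem7p2 (G : semigroupType) (C : set G) (Sigma : set (G -> G))
    (s : nat -> G) (k : nat) (col : G -> 'I_k) :
  subsemigroup C -> nice C ->
  finite_set Sigma -> Sigma !=set0 ->
  (forall sigma, Sigma sigma -> retraction C sigma) ->
  (forall i, ~ C (s i)) ->
  exists (n : nat -> nat) (a : nat -> G),
    [/\ forall i, (0 < n i)%N,
        forall i, (n i < n i.+1)%N,
        forall i, (fp_restr Sigma s (n i) (n i.+1) `\` C) (a i) &
        monochromatic col (fp Sigma [set: nat] a `\` C)].
Proof.
move=> CC niceC Sfin S0 SC sC.
have [u [v [[ultu ultv uF uC] [uu vv uv vu su]]]] :=
  ultra_idempotents CC niceC S0 SC sC.
have [c uc] : exists c, u [set x | col x = c].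
  apply: contrapT => /forallNP nuc.
  have : u [set x | forall c, [set: 'I_k] c -> (~` [set x | col x = c]) x].
    apply: (ultra_finite_forall ultu finite_finset) => c _.
    by rewrite ultu.1; exact/negP/nuc.
  by case/(ultra_ex ultu) => x /(_ (col x) I); apply.
(* A state holds the current bound [n i], a [u]-large set for products outside [C] and a [v]-large
   set for those inside. *)
pose state := (nat * set G * set G)%type.
have /choice[next nextP] (t : state) : exists r : G * nat,
    u t.1.2 -> v t.2 ->
    [/\ (t.1.1 < r.2)%N, (fp_restr Sigma s t.1.1 r.2 `\` C) r.1, t.1.2 r.1 &
      forall sigma, Sigma sigma -> t.2 (sigma r.1)] /\
    u (refine Sigma t.1.2 t.1.2 r.1) /\ v (refine Sigma t.1.2 t.2 r.1).
  have [[ut vt]|nuv] := pselect (u t.1.2 /\ v t.2).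
    have [a [m amP]] := ultra_choose_letter Sfin t.1.1
      ultu ultv uF uC uu vv uv vu su ut vt.
    by exists (a, m).
  (* An arbitrary value for states whose sets are not large; the recursion never reaches them. *)
  by exists (s 0%N, 0%N) => ut vt; case: nuv.
pose step (t : state) : state := ((next t).2,
  refine Sigma t.1.2 t.1.2 (next t).1, refine Sigma t.1.2 t.2 (next t).1).
(* Starting at 1 makes all bounds positive; [setT] puts no colour condition on products inside
   [C]. *)
pose st i := iter i step (1%N, [set x | col x = c], setT).
have uvst i : u (st i).1.2 /\ v (st i).2.
  elim: i => [|i [ui vi]]; first by split=> //; exact: ultra_setT.
  by have [_ []] := nextP _ ui vi.
have stP i := nextP _ (uvst i).1 (uvst i).2.
exists (fun i => (st i).1.1), (fun i => (next (st i)).1); split.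
- by case=> // i; have [[+ _ _ _] _] := stP i; exact: leq_ltn_trans.
- by move=> i; have [[+ _ _ _] _] := stP i.
- by move=> i; have [[_ + _ _] _] := stP i.
suff colc x : (fp Sigma [set: nat] (fun i => (next (st i)).1) `\` C) x ->
    col x = c by move=> x y /colc -> /colc ->.
case; apply: (fp_refine CC niceC SC (A := fun i => (st i).1.2)
  (B := fun i => (st i).2)) => // i.
- by have [[_ [_ +] _ _] _] := stP i.
- by have [[_ _ + _] _] := stP i.
- by have [[_ _ _ +] _] := stP i.
- exact: subset_refl.
- exact: subset_refl.
Qed.
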